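(* Let $G=(V,E)$ be an $n$-vertex unweighted, undirected, connected planar graph (with a fixed planar embedding) of diameter $D$, and let $S=\{s_1,\dots,s_\ell\}\subseteq V$ be a set of sources lying consecutively on a single face. Then the number of distinct $S$-distance tuples $\{\mathrm{tuple}_S(v): v\in V\}$ is $O(|S|^3D)$.
   Context: For $v\in V$, the $S$-distance tuple is $\mathrm{tuple}_S(v)=\langle d_G(s_1,v),\dots,d_G(s_\ell,v)\rangle$, where $d_G$ is the hop distance in $G$. ''Lying consecutively on a single face'' means $s_1,\dots,s_\ell$ form a contiguous segment of the boundary of one face of the embedding. *)

(* Defs.v *)
From HB Require Import structures.
From mathcomp Require Import all_boot all_fingroup.

Set Implicit Arguments.
Unset Strict Implicit.
Unset Printing Implicit Defensive.

Record sgraph := SGraph {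
  vertex :> finType;
  edge : rel vertex;
  edge_sym : symmetric edge;
  edge_irr : irreflexive edge }.

Definition connected_graph (G : sgraph) : Prop :=
  forall x y : G, connect (@edge G) x y.

Definition walk_len (G : sgraph) (k : nat) (x y : G) : bool :=
  [exists p : k.-tuple G, path (@edge G) x p && (last x p == y)].

(* Hop distance: the least k such that there is a walk with k edges from x to
   y. A shortest walk repeats no vertex, so k < #|G| suffices; the value is the
   junk #|G| when y is unreachable from x. *)
Definition dist (G : sgraph) (x y : G) : nat :=
  find (fun k => walk_len k x y) (iota 0 #|G|).

Definition diameter (G : sgraph) : nat := \max_(x : G) \max_(y : G) dist x y.

(* Oriented edges: every undirected edge gives two darts. *)
Definition dart (G : sgraph) := {d : G * G | edge d.1 d.2}.

Definition tail (G : sgraph) (d : dart G) : G := (val d).1.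

Lemma dart_rev_proof (G : sgraph) (d : dart G) :
  edge ((val d).2, (val d).1).1 ((val d).2, (val d).1).2.
Proof. by rewrite /= edge_sym; exact: (valP d). Qed.

Definition dart_rev (G : sgraph) (d : dart G) : dart G :=
  Sub ((val d).2, (val d).1) (dart_rev_proof d).

(* The cycles of sigma are exactly the sets of darts leaving a common vertex:
   sigma prescribes a cyclic order of the edges around each vertex. *)
Definition rotation_system (G : sgraph) (sigma : {perm dart G}) : Prop :=
  forall d d' : dart G, (d' \in porbit sigma d) = (tail d' == tail d).

(* The boundary walk of a face arriving at a vertex along d leaves it along the
   dart that follows the reverse of d in the rotation; the faces of the
   embedding are the orbits of this map. *)
Definition face_next (G : sgraph) (sigma : {perm dart G}) (d : dart G) :
  dart G := sigma (dart_rev d).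

(* The maximum accounts for the one-vertex graph, which has no dart but one
   face. *)
Definition nb_faces (G : sgraph) (sigma : {perm dart G}) : nat :=
  maxn 1 (fcard (face_next sigma) {: dart G}).

Definition nb_edges (G : sgraph) : nat := #|{: dart G}|./2.

(* A combinatorial embedding of a connected graph in the sphere: a rotation
   system of genus 0, i.e., satisfying Euler's formula V - E + F = 2. *)
Definition planar_embedding (G : sgraph) (sigma : {perm dart G}) : Prop :=
  rotation_system sigma /\ #|G| + nb_faces sigma = nb_edges G + 2.

(* s lists the vertices met along m consecutive steps of the boundary walk of
   the face of d, starting at d and going around at most once. The boundary walk
   passes several times through a cut vertex, so s may have repetitions. *)
Definition consecutive_on_face (G : sgraph) (sigma : {perm dart G})
    (s : seq G) : Prop :=
  exists (d : dart G) (m : nat),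
    m <= fingraph.order (face_next sigma) d /\
    s = [seq tail a | a <- traject (face_next sigma) d m].

Definition dist_tuple (G : sgraph) (s : seq G) (v : G) : seq nat :=
  [seq dist x v | x <- s].

Definition nb_dist_tuples (G : sgraph) (s : seq G) : nat :=
  size (undup [seq dist_tuple s v | v <- enum G]).

(* Main.v *)
(** A tuple is determined by the distance to the first source and by the signs of
    the differences [d(s_{i+1}, v) - d(s_i, v)], coded by two bits each, at the
    steps [i] that reach a new source. For two vertices [v] and [w] these bits
    cannot alternate four times: if the difference at step [i] is smaller for [v]
    than for [w], then a shortest path from [v] to [s_{i+1}] and one from [w] to
    [s_i] are disjoint, so four alternations give two shortest-path trees with
    eight leaves on one face, met in the order w v v w w v v w, such that the
    first, second, third and fourth v-branch avoids the w-branch of the same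
    rank. This is impossible since connected sets whose ends interleave on a face
    intersect. Bit vectors of length [n] without four alternations number at most
    [(n + 1)^3], by Pascal's recursion.

    The crossing property comes from Euler's formula: over F_2 it says that every
    cycle is a sum of face boundaries. *)

Require Import Defs.
From HB Require Import structures.
From mathcomp Require Import all_boot all_fingroup all_algebra zify.

Set Implicit Arguments.
Unset Strict Implicit.
Unset Printing Implicit Defensive.

Import GRing.Theory.

(** * Families of bit vectors with few alternations *)

Section Alternation.

(* x and y differ at r increasing positions, where x takes the values
   b, ~~ b, b, ... *)
Fixpoint alternates (b : bool) (r : nat) (x y : seq bool) : bool :=
  match x, y with
  | a :: x', c :: y' =>
      (if r is r'.+1 then [&& a == b, c == ~~ b & alternates (~~ b) r' x' y']
       else true) || alternates b r x' y'
  | _, _ => r == 0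
  end.

Lemma alternates_tail b r a c x y :
  alternates b r x y -> alternates b r (a :: x) (c :: y).
Proof. by rewrite /= orbC => ->. Qed.

(** Split by the first bit. The union of the two families of tails stays free of [r.+1]
    alternations. Two common tails gain an alternation when opposite bits are put in front, so the
    intersection is free of [r] alternations. *)
Lemma alternation_free_count n r (L : seq (seq bool)) :
    uniq L -> all (fun x => size x == n) L ->
    (forall b, {in L &, forall x y, ~~ alternates b r.+1 x y}) ->
  size L <= n.+1 ^ r.
Proof.
elim: n r L => [|n IHn] r L uL sL altL.
  rewrite exp1n -[1]/(size [:: [::] : seq bool]); apply: uniq_leq_size => // x xL.
  by rewrite inE -size_eq0 (allP sL).
pose F b := [seq behead x | x <- L & head false x == b].
have memF b x : (x \in F b) = (b :: x \in L).
  apply/mapP/idP => [[[|a y]]|bxL]; rewrite ?mem_filter.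
  - by move=> /andP[_ /(allP sL)].
  - by move=> /andP[/eqP <- ?] ->.
  by exists (b :: x); rewrite // mem_filter eqxx.
have uF b : uniq (F b).
  rewrite map_inj_in_uniq ?filter_uniq // => -[|a x] [|c y]; rewrite !mem_filter.
  - by [].
  - by move=> /andP[_ /(allP sL)].
  - by move=> _ /andP[_ /(allP sL)].
  by move=> /andP[/eqP/= -> _] /andP[/eqP/= -> _] ->.
have szL : size L = size (F true) + size (F false).
  rewrite !size_map !size_filter -(count_predC (fun x => head false x == true)).
  by congr (_ + _); apply: eq_count => x /=; case: (head _ _).
have sF b : all (fun x => size x == n) (F b).
  by apply/allP => x; rewrite memF => /(allP sL).
pose both := [seq x <- F false | x \in F true].
pose rest := [seq x <- F false | x \notin F true].
have szF : size (F false) = size both + size rest.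
  by rewrite !size_filter count_predC.
have leU : size (F true ++ rest) <= n.+1 ^ r.
  apply: IHn => [||b x y].
  - rewrite cat_uniq uF filter_uniq // andbT /=.
    by apply/hasPn => x; rewrite mem_filter => /andP[].
  - rewrite all_cat sF; apply/allP => x; rewrite mem_filter => /andP[_].
    exact: (allP (sF false)).
  have inL z : z \in F true ++ rest -> exists a, a :: z \in L.
    rewrite mem_cat mem_filter !memF => /orP[|/andP[_]]; first by exists true.
    by exists false.
  move=> /inL[a ax] /inL[c cy]; apply: contra (altL b _ _ ax cy).
  exact: alternates_tail.
have bothL b x : x \in both -> b :: x \in L.
  by rewrite mem_filter !memF; case: b => /andP[].
rewrite szL szF addnCA -size_cat.
case: r IHn altL leU => [|r] IHn altL leU.
  case E : both bothL => [|x s] bothL; first by rewrite add0n.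
  have xL b : b :: x \in L by apply: bothL; rewrite inE eqxx.
  by have := altL true _ _ (xL true) (xL false); rewrite /= ; case: (x).
have leI : size both <= n.+1 ^ r.
  apply: IHn => [||b x y xI yI]; first by rewrite filter_uniq.
    by apply/allP => x; rewrite mem_filter => /andP[_ /(allP (sF false))].
  apply: contra (altL (~~ b) _ _ (bothL (~~ b) x xI) (bothL b y yI)).
  by rewrite /= negbK !eqxx /= => ->.
(* With the new [r]: [(n + 1)^r + (n + 1)^(r + 1) = (n + 2) (n + 1)^r]. *)
apply: leq_trans (leq_add leI leU) _.
by rewrite !expnS -mulSn leq_mul //; case: (r) => // e; rewrite leq_exp2r.
Qed.

End Alternation.

(** * Homology of a plane map over F_2 *)

Section Homology.
Local Open Scope ring_scope.
Variables (G : sgraph) (sigma : {perm dart G}).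
Implicit Types (d : dart G) (u v : G).

Local Notation rev := (@dart_rev G).
Local Notation phi := (face_next sigma).

Lemma dart_revK : involutive rev.
Proof. by move=> d; apply: val_inj; case: d => -[]. Qed.

Lemma dart_rev_neq d : rev d != d.
Proof.
apply/eqP => /(congr1 (fun e => (val e).1)) /= E.
by case: d E => -[x y] /= xy E; move: xy; rewrite E /= edge_irr.
Qed.

Lemma face_next_inj : injective phi.
Proof. by move=> d d' /perm_inj /(can_inj dart_revK). Qed.

Lemma addrr_F2 (x : 'F_2) : x + x = 0.
Proof. by apply: addrr_pchar2; apply: pchar_Fp. Qed.

Lemma subr_F2 (x y : 'F_2) : x - y = x + y.
Proof. by congr (_ + _); apply: oppr_pchar2; apply: pchar_Fp. Qed.

Lemma addr_eq0_F2 (x y : 'F_2) : (x + y == 0) = (x == y).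
Proof. by rewrite -subr_F2 subr_eq0. Qed.

(** Picks one dart of every edge; these stand for the undirected edges that index the matrices. *)
Let positive d := (enum_rank d < enum_rank (rev d))%N.

Let positive_rev d : positive (rev d) = ~~ positive d.
Proof.
rewrite /positive dart_revK; case: ltngtP => //= /val_inj /enum_rank_inj E.
by case/eqP: (dart_rev_neq d).
Qed.

Let sum_positive (M : zmodType) (h : dart G -> M) :
  \sum_(d | positive d) (h d + h (rev d)) = \sum_d h d.
Proof.
rewrite big_split /= [RHS](bigID positive) /=; congr (_ + _).
rewrite [RHS](reindex_inj (can_inj dart_revK)).
by apply: eq_bigl => d; rewrite positive_rev negbK.
Qed.

Let card_positive : #|{: dart G}| = (#|positive|).*2.
Proof.
have rev_inj := can_inj dart_revK.
have E : #|[predC positive]| = #|positive|.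
  rewrite -(card_image rev_inj positive); apply: eq_card => d.
  by rewrite -[d in RHS]dart_revK (mem_image rev_inj) !unfold_in /= -positive_rev.
by rewrite -(cardC positive) E addnn.
Qed.

Let edges := #|positive|.
Let edge_dart (e : 'I_edges) : dart G := enum_val e.

Let sum_edges (M : zmodType) (h : dart G -> M) :
  \sum_e (h (edge_dart e) + h (rev (edge_dart e))) = \sum_d h d.
Proof. by rewrite -sum_positive [RHS]big_enum_val. Qed.

Let faces := #|froots phi|.

Lemma froot_in d : froot phi d \in froots phi.
Proof. by apply: roots_root; apply: fconnect_sym; apply: face_next_inj. Qed.

Let face_of d : 'I_faces := enum_rank_in (froot_in d) (froot phi d).

Let face_of_eq d d' : fconnect phi d d' -> face_of d = face_of d'.
Proof.
move=> /(fingraph.rootP (fconnect_sym face_next_inj)) E; rewrite /face_of.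
by apply: enum_val_inj; rewrite !enum_rankK_in ?froot_in.
Qed.

Let face_of_surj (f : 'I_faces) : exists d, face_of d = f.
Proof.
exists (enum_val f); apply: enum_val_inj.
rewrite enum_rankK_in ?froot_in //.
by apply/eqP; have := enum_valP f; rewrite unfold_in.
Qed.

(** The two boundary maps of the cellular chain complex over F_2. In [boundary], an edge with the
    same face on both sides contributes 1 + 1 = 0. *)
Let incidence : 'M['F_2]_(edges, #|G|) :=
  \matrix_(e, v) ((enum_rank (tail (edge_dart e)) == v)%:R
                  + (enum_rank (tail (rev (edge_dart e))) == v)%:R).

Let boundary : 'M['F_2]_(faces, edges) :=
  \matrix_(f, e) ((face_of (edge_dart e) == f)%:R
                  + (face_of (rev (edge_dart e)) == f)%:R).

Lemma sum_delta (R : nzRingType) (I : finType) (h : I -> R) (i : I) :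
  \sum_j h j * (i == j)%:R = h i.
Proof.
rewrite (bigD1 i) //= eqxx mulr1 big1 ?addr0 // => j /negbTE.
by rewrite eq_sym => ->; rewrite mulr0.
Qed.

(** The left kernel lies in the line of constant vectors. This turns connectedness of the graph and
    of its dual into rank bounds. *)
Lemma rank_of_constant_kernel (F : fieldType) m n (A : 'M[F]_(m, n)) :
    (forall x : 'rV_m, x *m A = 0 -> forall i j, x 0 i = x 0 j) ->
  (m <= (\rank A).+1)%N.
Proof.
move=> kerA; rewrite -addn1 -leq_subLR -mxrank_ker.
apply: leq_trans (rank_leq_row (const_mx 1 : 'rV[F]_m)); apply: mxrankS.
apply/row_subP => i; set x := row i _.
have x_cst : forall j k, x 0 j = x 0 k.
  by apply: kerA; rewrite -row_mul mulmx_ker row0.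
have -> : x = x 0 i *: const_mx 1.
  by apply/rowP => j; rewrite (x_cst j i) !mxE mulr1.
exact: scalemx_sub.
Qed.

Hypotheses (Gconn : connected_graph G) (planar : planar_embedding sigma).

Lemma tail_sigma d : tail (sigma d) = tail d.
Proof. by apply/eqP; rewrite -(proj1 planar) (mem_porbit sigma 1 d). Qed.

Lemma tail_next d : tail (phi d) = tail (rev d).
Proof. exact: tail_sigma. Qed.

Lemma constant_on_vertices (T : Type) (h : G -> T) :
  (forall d, h (tail d) = h (tail (rev d))) -> forall u v, h u = h v.
Proof.
move=> hd u v; have /connectP[p] := Gconn u v.
elim: p u => [|w p IHp] u /= => [_ ->//|/andP[uw wp] vE].
by rewrite -(IHp w) //; exact: (hd (Sub (u, w) uw)).
Qed.

(** This is connectedness of the dual: [sigma d] is [phi (rev d)], so [h] is constant around each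
    vertex, and [rev] carries its value along the edges. *)
Lemma constant_on_darts (T : Type) (h : dart G -> T) :
    (forall d, h (phi d) = h d) -> (forall d, h (rev d) = h d) ->
  forall d d', h d = h d'.
Proof.
move=> hphi hrev.
have hsigma d : h (sigma d) = h d by rewrite -{1}(dart_revK d) hphi.
have htail d d' : tail d' = tail d -> h d' = h d.
  move/eqP; rewrite -(proj1 planar) => /porbitP[k ->].
  by elim: k => [|k IHk]; rewrite ?expg0 ?perm1 // expgSr permM hsigma.
move=> d d'; have /connectP[p] := Gconn (tail d) (tail d').
elim: p d => [|w p IHp] d /= => [_ /htail//|/andP[dw wp] d'E].
rewrite -(htail d (Sub (tail d, w) dw)) // -hrev.
exact: IHp.
Qed.

Let rank_incidence : (#|G| <= (\rank incidence).+1)%N.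
Proof.
rewrite -mxrank_tr; apply: rank_of_constant_kernel => x xN i j.
pose h v := x 0 (enum_rank v).
suff hd d : h (tail d) = h (tail (rev d)).
  by rewrite -(enum_valK i) -(enum_valK j); apply: constant_on_vertices hd _ _.
wlog pos_d : d / positive d => [IH|].
  case: (boolP (positive d)) => [/IH//|]; rewrite -positive_rev => /IH.
  by rewrite dart_revK.
have dE : edge_dart (enum_rank_in pos_d d) = d by rewrite /edge_dart enum_rankK_in.
have /matrixP/(_ 0 (enum_rank_in pos_d d)) := xN.
rewrite !mxE => /eqP; under eq_bigr => k _ do rewrite !mxE dE mulrDr.
by rewrite big_split /= !sum_delta addr_eq0_F2 => /eqP.
Qed.

Let rank_boundary : (faces <= (\rank boundary).+1)%N.
Proof.
apply: rank_of_constant_kernel => x xB i j.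
pose h d := x 0 (face_of d).
have hphi d : h (phi d) = h d by rewrite /h (face_of_eq (fconnect1 _ d)).
suff hrev d : h (rev d) = h d.
  have [[d <-] [d' <-]] := (face_of_surj i, face_of_surj j).
  exact: constant_on_darts hphi hrev d d'.
wlog pos_d : d / positive d => [IH|].
  case: (boolP (positive d)) => [/IH//|]; rewrite -positive_rev => /IH.
  by rewrite dart_revK.
have dE : edge_dart (enum_rank_in pos_d d) = d by rewrite /edge_dart enum_rankK_in.
have /matrixP/(_ 0 (enum_rank_in pos_d d)) := xB.
rewrite !mxE => /eqP; under eq_bigr => k _ do rewrite !mxE dE mulrDr.
by rewrite big_split /= !sum_delta addr_eq0_F2 => /eqP.
Qed.

(** A face walk enters each vertex as often as it leaves it, since [phi d] starts where [d] ends. *)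
Let boundary_incidence : boundary *m incidence = 0.
Proof.
apply/matrixP => f v; rewrite !mxE.
pose in_f d : 'F_2 := (face_of d == f)%:R.
pose at_v d : 'F_2 := (enum_rank (tail d) == v)%:R.
pose k d := in_f d * (at_v d + at_v (rev d)).
rewrite (eq_bigr (fun e => k (edge_dart e) + k (rev (edge_dart e)))); last first.
  move=> e _; rewrite !mxE /k dart_revK mulrDl.
  by congr (_ + _ * _); rewrite addrC.
rewrite (sum_edges k) /k.
under eq_bigr => d _ do rewrite mulrDr.
rewrite big_split /= [X in X + _](reindex_inj face_next_inj) /=.
rewrite [X in X + _](eq_bigr (fun d => in_f d * at_v (rev d))) ?addrr_F2 // => d _.
by rewrite /in_f /at_v tail_next (face_of_eq (fconnect1 _ d)).
Qed.

(* Over F_2 every cycle is a sum of face boundaries: the face boundaries span a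
   space of dimension F - 1, the cycles one of dimension E - (V - 1), and these
   agree by Euler's formula. *)
Lemma cycle_bounds (d0 : dart G) (z : dart G -> 'F_2) :
    (forall d, z (rev d) = z d) ->
    (forall v, \sum_(d | tail d == v) z d = 0) ->
  exists c : dart G -> 'F_2,
    (forall d, c (phi d) = c d) /\ (forall d, c d + c (rev d) = z d).
Proof.
move=> z_rev z_cycle.
have cardF : faces = fcard phi {: dart G}.
  by apply: eq_card => d; rewrite !inE andbT.
(* The face of [d0] resolves the maximum in [nb_faces]. *)
have euler : (#|G| + faces = edges + 2)%N.
  have := proj2 planar; rewrite /nb_faces /nb_edges card_positive doubleK.
  by rewrite -cardF (maxn_idPr (leq_ltn_trans (leq0n _) (ltn_ord (face_of d0)))).
have sub : (boundary <= kermx incidence)%MS.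
  by apply/sub_kermxP; exact: boundary_incidence.
(* The kernel has dimension at most [E - V + 1 = F - 1], which is at most the rank of [boundary]. *)
have ker_sub : (kermx incidence <= boundary)%MS.
  rewrite -(mxrank_leqif_sup sub) eqn_leq mxrankS //= mxrank_ker.
  move: (\rank incidence) (\rank boundary) rank_incidence rank_boundary euler.
  by move: #|G| faces edges; lia.
pose zr : 'rV_edges := \row_e z (edge_dart e).
have /submxP[x xE] : (zr <= boundary)%MS.
  apply: submx_trans ker_sub; apply/sub_kermxP/matrixP => i v; rewrite !mxE.
  pose k d := z d * (enum_rank (tail d) == v)%:R.
  rewrite (eq_bigr (fun e => k (edge_dart e) + k (rev (edge_dart e)))).
    rewrite (sum_edges k) -[RHS](z_cycle (enum_val v)) [RHS]big_mkcond /=.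
    apply: eq_bigr => d _; rewrite /k -(inj_eq enum_val_inj) enum_rankK.
    by case: eqP => _; rewrite ?mulr1 ?mulr0.
  by move=> e _; rewrite !mxE /k z_rev mulrDr.
pose c d := x 0 (face_of d); exists c; split=> [d|d].
  by rewrite /c (face_of_eq (fconnect1 _ d)).
wlog pos_d : d / positive d => [IH|].
  case: (boolP (positive d)) => [/IH//|]; rewrite -positive_rev => /IH.
  by rewrite dart_revK addrC z_rev.
have dE : edge_dart (enum_rank_in pos_d d) = d by rewrite /edge_dart enum_rankK_in.
have /matrixP/(_ 0 (enum_rank_in pos_d d)) := xE.
rewrite !mxE dE => ->; under eq_bigr => k _ do rewrite !mxE dE mulrDr.
by rewrite big_split /= !sum_delta.
Qed.

End Homology.

(** * Connected sets crossing a disc *)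

Section Crossing.
Local Open Scope ring_scope.
Variables (G : sgraph) (sigma : {perm dart G}).
Hypotheses (Gconn : connected_graph G) (planar : planar_embedding sigma).
Implicit Types (A B : {set G}) (d : dart G) (u v x y : G).

Local Notation rev := (@dart_rev G).
Local Notation phi := (face_next sigma).

Definition linked A x y :=
  (x \in A) && connect [rel u v | [&& edge u v, u \in A & v \in A]] x y.

Lemma linked_refl A x : x \in A -> linked A x x.
Proof. by rewrite /linked connect0 andbT. Qed.

Lemma linked_edge A x y : edge x y -> x \in A -> y \in A -> linked A x y.
Proof. by move=> xy Ax Ay; rewrite /linked Ax connect1 //= xy Ax Ay. Qed.

Lemma linked_in A x y : linked A x y -> x \in A /\ y \in A.
Proof.
move=> /andP[Ax /connectP[p xp yE]]; split=> //.
elim: p x Ax xp yE => [|w p IHp] x Ax /=.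
  by move=> _ ->.
by move=> /andP[/and3P[_ _ Aw] /(IHp w Aw)].
Qed.

Lemma linked_trans A : transitive (linked A).
Proof.
move=> y x z /andP[Ax xy] /andP[_ yz].
by rewrite /linked Ax (connect_trans xy yz).
Qed.

Lemma linked_sym A x y : linked A x y -> linked A y x.
Proof.
move=> xy; have [_ Ay] := linked_in xy; move/andP: xy => [_ xy].
rewrite /linked Ay sym_connect_sym // => u v /=.
by rewrite edge_sym [(u \in A) && _]andbC.
Qed.

Lemma linked_sub A B x y : A \subset B -> linked A x y -> linked B x y.
Proof.
move=> /subsetP sAB /andP[Ax xy]; rewrite /linked sAB //=.
apply: connect_sub xy => u v /and3P[uv Au Av].
by apply: connect1; rewrite /= uv !sAB.
Qed.

Lemma sum_dart d v : \sum_(d' | tail d' == v) (d' == d)%:R = (v == tail d)%:R :> 'F_2.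
Proof.
rewrite big_mkcond (bigD1 d) //= eqxx big1 => [|d' /negbTE ->].
  by rewrite addr0 eq_sym; case: eqP.
by case: ifP.
Qed.

(** Count the edges of a walk in [A] modulo 2; at inner vertices the contributions cancel. *)
Lemma linked_chain A x y : linked A x y ->
  exists z : dart G -> 'F_2,
    [/\ forall d, z (rev d) = z d, forall d, tail d \notin A -> z d = 0 &
        forall v, \sum_(d | tail d == v) z d = (v == x)%:R + (v == y)%:R].
Proof.
move=> /andP[Ax /connectP[p]]; elim: p x Ax => [|w p IHp] x Ax /=.
  move=> _ ->; exists (fun=> 0); split=> // v.
  by rewrite big1 // addrr_F2.
move=> /andP[/and3P[xw _ Aw] wp] yE.
have [z [z_rev zA z_bd]] := IHp w Aw wp yE.
pose e : dart G := Sub (x, w) xw.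
exists (fun d => z d + ((d == e)%:R + (d == rev e)%:R)); split=> [d|d dA|v].
- rewrite z_rev; congr (_ + _); rewrite addrC; congr (_ + _).
    by rewrite (inj_eq (can_inj (@dart_revK G))).
  by rewrite -(inj_eq (can_inj (@dart_revK G))) dart_revK.
- rewrite zA // add0r !(introF eqP) ?addr0 // => dE; move: dA; rewrite dE.
    by rewrite /= Aw.
  by rewrite /= Ax.
rewrite !big_split /= !sum_dart z_bd -/(tail e) addrC -addrA; congr (_ + _).
by rewrite addrA addrr_F2 add0r.
Qed.

Section Face.
Variable d0 : dart G.

Definition corner k := tail (iter k phi d0).

(** A chain over F_2; within one turn of the face it is the indicator of the darts leaving the
    corners [i] to [j - 1]. *)
Let in_segment i j d : 'F_2 := \sum_(i <= k < j) (d == iter k phi d0)%:R.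

Let telescope i j (h : nat -> 'F_2) : (i <= j)%N ->
  \sum_(i <= k < j) (h k + h k.+1) = h i + h j.
Proof.
move=> le_ij; rewrite addrC -subr_F2 -(telescope_sumr h le_ij).
by apply: eq_bigr => k _; rewrite subr_F2 addrC.
Qed.

Let segment_next i j d : (i <= j)%N ->
  in_segment i j (phi d) + in_segment i j d
    = (phi d == iter i phi d0)%:R + (phi d == iter j phi d0)%:R.
Proof.
move=> le_ij; rewrite -(telescope (fun k => (phi d == iter k phi d0)%:R)) //.
rewrite big_split /=; congr (_ + _); apply: eq_bigr => k _.
by rewrite (inj_eq (@face_next_inj _ sigma)).
Qed.

Let segment_boundary i j v : (i <= j)%N ->
  \sum_(d | tail d == v) (in_segment i j d + in_segment i j (rev d))
    = (v == corner i)%:R + (v == corner j)%:R.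
Proof.
move=> le_ij; rewrite -(telescope (fun k => (v == corner k)%:R)) //.
rewrite big_split /= /in_segment exchange_big /= [X in _ + X]exchange_big /=.
rewrite -big_split; apply: eq_bigr => k _ /=; rewrite sum_dart; congr (_ + _).
rewrite /corner iterS (tail_next planar) -sum_dart; apply: eq_bigr => d _.
by rewrite -(inj_eq (can_inj (@dart_revK G))) dart_revK.
Qed.

Let iter_inj i j : (i < fingraph.order phi d0)%N -> (j < fingraph.order phi d0)%N ->
  (iter i phi d0 == iter j phi d0) = (i == j).
Proof.
move=> lt_i lt_j; rewrite -!(nth_traject _ lt_i) -!(nth_traject _ lt_j).
by rewrite nth_uniq ?size_traject //; exact: orbit_uniq.
Qed.

Let in_segmentE i j k : (j <= fingraph.order phi d0)%N -> (k < fingraph.order phi d0)%N ->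
  in_segment i j (iter k phi d0) = (i <= k < j)%N%:R.
Proof.
move=> le_j lt_k; rewrite /in_segment.
have E l : (i <= l < j)%N -> ((iter k phi d0 == iter l phi d0)%:R : 'F_2) = (k == l)%:R.
  by move=> /andP[_ lt_l]; rewrite iter_inj // (leq_trans lt_l).
rewrite (eq_big_nat _ _ E); case: (boolP (i <= k < j)%N) => kij.
  rewrite (big_rem k) ?mem_index_iota //= eqxx big1_seq ?addr0 // => l /=.
  by rewrite (rem_filter _ (iota_uniq _ _)) mem_filter /= eq_sym => /andP[/negbTE->].
rewrite big1_seq // => l; rewrite mem_index_iota /=; case: eqP => // <- kij'.
by rewrite kij' in kij.
Qed.

(* A chain in A from the first corner to the third, closed up along the face, is
   the boundary of a set of faces; splitting the given face along the chord
   turns this set into a colouring of the darts that changes only at A. *)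
Lemma linked_cross A B i j k l :
    (i <= j <= k)%N -> (k <= l < fingraph.order phi d0)%N ->
    linked A (corner i) (corner k) -> linked B (corner j) (corner l) ->
  ~~ [disjoint A & B].
Proof.
move=> /andP[le_ij le_jk] /andP[le_kl lt_l] lkA lkB; apply/negP => disAB.
have [Ai Ak] := linked_in lkA; have [Bj _] := linked_in lkB.
have le_ik := leq_trans le_ij le_jk.
have BA u : u \in B -> u \notin A by move=> uB; rewrite (disjointFl disAB).
(* Strictness places [j] inside the half-open segment from [i] to [k]. *)
have lt_jk : (j < k)%N.
  rewrite ltn_neqAle le_jk andbT; apply/eqP => jk.
  by move/BA: Bj; rewrite jk Ak.
have [w [w_rev wA w_bd]] := linked_chain lkA.
pose seg := in_segment i k.
have [d|v|c [c_next c_rev]] := cycle_bounds Gconn planar d0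
  (z := fun d => w d + (seg d + seg (rev d))).
- by rewrite w_rev dart_revK [seg _ + _]addrC.
- by rewrite big_split /= w_bd segment_boundary // addrr_F2.
(* The values of [c] on the two sides of an edge differ by [w] and the segment terms; adding [seg]
   leaves only [w], which vanishes off [A]. *)
pose col d := c d + seg d.
have col_rev d : tail d \notin A -> col (rev d) = col d.
  move=> /wA wd0; apply/esym/eqP; rewrite -addr_eq0_F2 /col addrACA c_rev.
  by rewrite wd0 add0r addrr_F2.
have col_sigma d : tail d \notin A -> col (sigma d) = col d.
  move=> dA; rewrite -(col_rev d dA) -[X in sigma X]dart_revK.
  rewrite -/(phi (rev d)) /col c_next; congr (_ + _).
  (* Along the face, [seg] changes only at the corners [i] and [k], both in [A]. *)
  have neq n : corner n \in A -> (phi (rev d) == iter n phi d0) = false.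
    move=> An; apply: contraNF dA => /eqP E.
    by rewrite -[d]dart_revK -(tail_next planar) E.
  by apply/eqP; rewrite -addr_eq0_F2 segment_next // !neq // addr0.
have col_tail d d' : tail d \notin A -> tail d' = tail d -> col d' = col d.
  move=> dA /eqP; rewrite -(proj1 planar) => /porbitP[n ->].
  elim: n => [|n IHn]; rewrite ?expg0 ?perm1 // expgSr permM col_sigma //.
  have /eqP-> // : tail ((sigma ^+ n)%g d) == tail d.
  by rewrite -(proj1 planar) mem_porbit.
have col_linked d d' : linked B (tail d) (tail d') -> col d = col d'.
  move=> /andP[Bd /connectP[p]]; elim: p d Bd => [|u p IHp] d Bd /=.
    by move=> _ E; rewrite (col_tail _ _ (BA _ Bd) E).
  move=> /andP[/and3P[du _ Bu] up] E; pose e : dart G := Sub (tail d, u) du.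
  rewrite -(col_tail d e) ?BA // -col_rev ?BA //; exact: IHp.
(* As [c] is constant on the face, the colours at the corners [j] and [l] differ as [seg] does: it
   is 1 at [j] and 0 at [l]. *)
have c_iter n : c (iter n phi d0) = c d0 by elim: n => //= n <-.
have /eqP := col_linked (iter j phi d0) (iter l phi d0) lkB.
rewrite /col !c_iter (inj_eq (addrI _)) /seg !in_segmentE //; last 3 first.
- exact: leq_trans le_kl (ltnW lt_l).
- exact: leq_trans le_kl (ltnW lt_l).
- exact: leq_ltn_trans (leq_trans le_jk le_kl) lt_l.
by rewrite le_ij lt_jk [(l < k)%N]ltnNge le_kl andbF.
Qed.

End Face.

End Crossing.

(** * Distances and shortest-path trees *)

Section Distance.
Variable G : sgraph.
Implicit Types (u v w x y z : G) (p : seq G).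

Lemma walk_lenP k x y :
  reflect (exists p, [/\ size p = k, path (@edge G) x p & last x p = y])
          (walk_len k x y).
Proof.
apply: (iffP existsP) => [[p /andP[xp /eqP yE]]|[p [<- xp yE]]].
  by exists p; rewrite size_tuple.
by exists (in_tuple p); rewrite /= xp yE eqxx.
Qed.

Lemma dist_le_walk x p : path (@edge G) x p -> dist x (last x p) <= size p.
Proof.
(* For a walk of [#|G|] edges or more the bound is that [find] never exceeds the length [#|G|] of
   its list. *)
move=> xp; case: (ltnP (size p) #|G|) => [lt_p|]; last first.
  by apply: leq_trans; rewrite -[#|G|](size_iota 0) find_size.
rewrite leqNgt; apply/negP => /(before_find 0); rewrite nth_iota // add0n.
by move=> /negbT/walk_lenP[]; exists p.
Qed.

Lemma dist_refl x : dist x x = 0.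
Proof. by apply/eqP; rewrite -leqn0; exact: (@dist_le_walk x [::]). Qed.

Lemma dist_edge x y : edge x y -> dist x y <= 1.
Proof. by move=> xy; apply: (@dist_le_walk x [:: y]); rewrite /= xy. Qed.

Hypothesis Gconn : connected_graph G.

Lemma dist_walk x y :
  exists p, [/\ size p = dist x y, path (@edge G) x p & last x p = y].
Proof.
apply/walk_lenP; have /connectP[p /shortenP[q xq uq _] yE] := Gconn x y.
have lt_q : size q < #|G| by rewrite -[_ < _]/(size (x :: q) <= _) -(card_uniqP uq) max_card.
have has_q : has (fun k => walk_len k x y) (iota 0 #|G|).
  apply/hasP; exists (size q); first by rewrite mem_iota.
  by apply/walk_lenP; exists q.
have := nth_find 0 has_q; rewrite nth_iota //.
by move: has_q; rewrite has_find size_iota.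
Qed.

Lemma dist_triangle y x z : dist x z <= dist x y + dist y z.
Proof.
have [p [<- xp <-]] := dist_walk x y; have [q [<- yq <-]] := dist_walk (last x p) z.
by rewrite -last_cat -size_cat dist_le_walk // cat_path xp.
Qed.

Lemma dist_sym x y : dist x y = dist y x.
Proof.
suff le u v : dist u v <= dist v u by apply/eqP; rewrite eqn_leq !le.
have [p [<- vp <-]] := dist_walk v u.
have := @dist_le_walk (last v p) (rev (belast v p)).
rewrite size_rev size_belast rev_path (eq_path (e' := @edge G)); last first.
  by move=> ? ? /=; rewrite edge_sym.
move/(_ vp); have -> // : last (last v p) (rev (belast v p)) = v.
by case: p {vp} => //= t p; rewrite rev_cons last_rcons.
Qed.

Lemma dist_step v x : x != v ->
  exists2 u, edge x u & dist v x = (dist v u).+1.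
Proof.
have [p [pE vp xE]] := dist_walk v x; rewrite -xE in pE *; case/lastP: p {xE} pE vp => [|p y].
  by rewrite eqxx.
rewrite size_rcons rcons_path last_rcons => pE /andP[vp uy] _.
exists (last v p); first by rewrite edge_sym.
apply/eqP; rewrite eqn_leq -pE !ltnS dist_le_walk // andbT.
rewrite -ltnS pE -addn1 (leq_trans (dist_triangle (last v p) _ _)) //.
by rewrite leq_add2l dist_edge.
Qed.

(** The father of [x] in a shortest-path tree rooted at [v]. Fixing the root makes branches forward
    orbits of a function; the default [x] is junk for unreachable vertices. *)
Definition parent v x :=
  if x == v then v else odflt x [pick u | edge x u && (dist v x == (dist v u).+1)].

Lemma parentP v x :
  x = v /\ parent v x = v \/
  edge x (parent v x) /\ dist v x = (dist v (parent v x)).+1.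
Proof.
rewrite /parent; case: eqVneq => [->|/dist_step[u xu uE]]; [by left|right].
case: pickP => [w /andP[? /eqP]//|/(_ u)].
by rewrite xu uE eqxx.
Qed.

Lemma parent_edge v x : parent v x = x \/ edge x (parent v x).
Proof. by have [[-> ->]|[xp _]] := parentP v x; [left|right]. Qed.

Lemma parent_root v x : fconnect (parent v) x v.
Proof.
have [n] := ubnP (dist v x); elim: n x => // n IHn x; rewrite ltnS => le_n.
have [[-> _]|[_ xE]] := parentP v x; first exact: connect0.
apply: connect_trans (fconnect1 _ x) (IHn _ _).
by rewrite -ltnS -xE.
Qed.

(** Branches are shortest paths: each [parent] step off the root lowers the distance to [v] by
    one. *)
Lemma dist_ancestor v x z :
  fconnect (parent v) x z -> dist v z + dist z x <= dist v x.
Proof.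
move/iter_findex <-; elim: (findex _ _ _) => [|n IHn] /=.
  by rewrite dist_refl addn0.
set y := iter n _ x in IHn *; have [[yE ->]|[yp yE]] := parentP v y.
  by move: IHn; rewrite yE.
apply: leq_trans IHn; rewrite yE addSnnS leq_add2l.
rewrite (leq_trans (dist_triangle y _ _)) // -add1n leq_add2r.
by rewrite dist_edge // edge_sym.
Qed.

End Distance.

(** * Two trees with leaves on a face *)

Section Trees.
Variable G : sgraph.
Implicit Types (f g : G -> G) (r x y z : G).

Definition tree_path f x z : {set G} :=
  [set y | fconnect f x y && fconnect f y z].

Lemma linked_tree_path f x z : (forall y, f y = y \/ edge y (f y)) ->
  fconnect f x z -> linked (tree_path f x z) x z.
Proof.
move=> f_edge /iter_findex <-; move: (findex _ _ _) => n {z}.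
elim: n x => [|n IHn] x; first by rewrite linked_refl // inE !connect0.
rewrite iterSr; set z := iter n f (f x).
have fxz : fconnect f (f x) z by exact: fconnect_iter.
have xz : fconnect f x z by exact: connect_trans (fconnect1 f x) fxz.
apply: (@linked_trans _ _ (f x)); last first.
  apply: linked_sub (IHn _); apply/subsetP => y; rewrite !inE => /andP[xy ->].
  by rewrite (connect_trans (fconnect1 f x) xy).
have [->|x_fx] := f_edge x; first by rewrite linked_refl // inE connect0.
by apply: linked_edge x_fx _ _; rewrite inE ?connect0 ?fconnect1.
Qed.

Definition meets f g x y := [exists z, fconnect f x z && fconnect g y z].

Lemma meetsC f g x y : meets f g x y = meets g f y x.
Proof. by apply: eq_existsb => z; rewrite andbC. Qed.

Lemma meets_at f g x y z : fconnect f x z -> fconnect g y z -> meets f g x y.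
Proof. by move=> xz yz; apply/existsP; exists z; rewrite xz. Qed.

(** The property that [linked_cross] gives for interleaving corners, freed from the face so that the
    tree arguments use vertices only. *)
Definition crossing x1 x2 y1 y2 :=
  forall A B : {set G}, linked A x1 x2 -> linked B y1 y2 -> ~~ [disjoint A & B].

Lemma crossingC x1 x2 y1 y2 : crossing x1 x2 y1 y2 -> crossing y1 y2 x1 x2.
Proof. by move=> cr A B Ay Bx; rewrite disjoint_sym cr. Qed.

Lemma crossing_swap x1 x2 y1 y2 : crossing x1 x2 y1 y2 -> crossing x1 x2 y2 y1.
Proof. by move=> cr A B Ax /linked_sym By; apply: cr. Qed.

Definition join f g x y z := tree_path f x z :|: tree_path g y z.

Definition tree_fun f r :=
  (forall y, f y = y \/ edge y (f y)) /\ (forall x, fconnect f x r).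

Section TwoTrees.
Variables (f g : G -> G) (v w : G).
Hypotheses (f_tree : tree_fun f v) (g_tree : tree_fun g w).

Lemma linked_join x y z :
  fconnect f x z -> fconnect g y z -> linked (join f g x y z) x y.
Proof.
move=> xz yz; apply: (@linked_trans _ _ z); last apply: linked_sym.
  by apply: linked_sub (subsetUl _ _) _; apply: linked_tree_path xz; case: f_tree.
by apply: linked_sub (subsetUr _ _) _; apply: linked_tree_path yz; case: g_tree.
Qed.
End TwoTrees.

Section Meets.
Variables (f g : G -> G) (v w : G).
Hypotheses (f_tree : tree_fun f v) (g_tree : tree_fun g w).

(** The path from [x1] to [x2] through [v] intersects the one from [y1] to [y2] through [w], and a
    common vertex lies on one branch of each tree. *)
Lemma crossing_meets x1 x2 y1 y2 : crossing x1 x2 y1 y2 ->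
  [|| meets f g x1 y1, meets f g x1 y2, meets f g x2 y1 | meets f g x2 y2].
Proof.
move=> cr.
have lkf := linked_join f_tree f_tree (proj2 f_tree x1) (proj2 f_tree x2).
have lkg := linked_join g_tree g_tree (proj2 g_tree y1) (proj2 g_tree y2).
have /pred0Pn[u /andP[]] := cr _ _ lkf lkg; rewrite !inE.
by move=> /orP[]/andP[xu _] /orP[]/andP[yu _]; rewrite (meets_at xu yu) ?orbT.
Qed.

(** The path from [x] to [y] through their meeting point crosses the one from [x1] to [x2]. If it
    does so on the branch of [x], the crossing branch follows [f] from there to the meeting
    point. *)
Lemma meets_cross_left x1 x2 x y : crossing x1 x2 x y -> meets f g x y ->
  meets f g x1 y || meets f g x2 y.
Proof.
move=> cr /existsP[z /andP[xz yz]].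
have lkf := linked_join f_tree f_tree (proj2 f_tree x1) (proj2 f_tree x2).
have /pred0Pn[u /andP[]] := cr _ _ lkf (linked_join f_tree g_tree xz yz).
rewrite !inE => /orP[]/andP[xu _] /orP[]/andP[yu uz].
- by rewrite (meets_at (connect_trans xu uz) yz).
- by rewrite (meets_at xu yu).
- by rewrite (meets_at (connect_trans xu uz) yz) orbT.
- by rewrite (meets_at xu yu) orbT.
Qed.

(** Consider a common vertex of the two joining paths. If both follow [f] there, or both [g], one
    branch runs on to the meeting point of the other pair; otherwise an [f]-branch and a [g]-branch
    meet at this vertex. *)
Lemma meets_exchange x y x' y' : crossing x y x' y' ->
  meets f g x y -> meets f g x' y' -> meets f g x y' || meets f g x' y.
Proof.
move=> cr /existsP[z /andP[xz yz]] /existsP[z' /andP[xz' yz']].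
have lk := linked_join f_tree g_tree xz yz.
have lk' := linked_join f_tree g_tree xz' yz'.
have /pred0Pn[u /andP[]] := cr _ _ lk lk'.
rewrite !inE => /orP[]/andP[xu uz] /orP[]/andP[yu uz'].
- by rewrite (meets_at (connect_trans xu uz') yz').
- by rewrite (meets_at xu yu).
- by rewrite (meets_at yu xu) orbT.
- by rewrite (meets_at xz' (connect_trans xu uz')) orbT.
Qed.
End Meets.

Lemma meets_cross_right f g v w y1 y2 x y :
    tree_fun f v -> tree_fun g w ->
    crossing y1 y2 x y -> meets f g x y ->
  meets f g x y1 || meets f g x y2.
Proof.
move=> fT gT /crossing_swap cr; rewrite !(meetsC f).
exact (meets_cross_left gT fT cr).
Qed.

(* Write i -> j if the f-branch of p_i meets the g-branch of q_j. Then
   2 -> 4, as crossing gives 2 -> 4, 3 -> 2 or 3 -> 4, with 3 -> 2 => 3 -> 4 and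
   3 -> 4 => 2 -> 4; further 2 -> 4 => 2 -> 1 => 4 -> 1 and 2 -> 4 => 1 -> 4, but
   1 -> 4 and 4 -> 1 exclude each other. *)
Lemma no_disjoint_trees f g v w (c : nat -> G) n q1 p1 p2 q2 q3 p3 p4 q4 :
    tree_fun f v -> tree_fun g w ->
    (forall i j k l, i <= j <= k -> k <= l < n ->
       crossing (c i) (c k) (c j) (c l)) ->
    sorted leq [:: q1; p1; p2; q2; q3; p3; p4; q4] -> q4 < n ->
    ~~ meets f g (c p1) (c q1) -> ~~ meets f g (c p2) (c q2) ->
    ~~ meets f g (c p3) (c q3) -> ~~ meets f g (c p4) (c q4) ->
  False.
Proof.
move=> fT gT cr /and5P[q1p1 p1p2 p2q2 q2q3 /and4P[q3p3 p3p4 p4q4 _]] q4n.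
move=> /negbTE m11 /negbTE m22 /negbTE m33 /negbTE m44.
have m24 : meets f g (c p2) (c q4).
  have m34_m24 : meets f g (c p3) (c q4) -> meets f g (c p2) (c q4).
    move/(meets_cross_left fT gT (x1 := c p2) (x2 := c p4)); rewrite m44 orbF.
    by apply; apply: cr; lia.
  have := crossing_meets fT gT (cr p2 q2 p3 q4 _ _); rewrite m22 /=.
  case/(_ _ _)/or3P; [lia|lia|by []| |exact: m34_m24].
  move/(meets_cross_right fT gT (y1 := c q3) (y2 := c q4)); rewrite m33 /=.
  by move=> H; apply: m34_m24; apply: H; apply/crossing_swap/crossingC/cr; lia.
have m21 : meets f g (c p2) (c q1).
  move: m24 => /(meets_cross_right fT gT (y1 := c q1) (y2 := c q2)).
  by rewrite m22 orbF; apply; apply: cr; lia.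
have m41 : meets f g (c p4) (c q1).
  move: m21 => /(meets_cross_left fT gT (x1 := c p1) (x2 := c p4)).
  by rewrite m11 /=; apply; apply/crossing_swap/crossingC/cr; lia.
have m14 : meets f g (c p1) (c q4).
  move: m24 => /(meets_cross_left fT gT (x1 := c p1) (x2 := c p4)).
  by rewrite m44 orbF; apply; apply: cr; lia.
have cr14 : crossing (c p1) (c q4) (c p4) (c q1).
  by apply/crossing_swap/crossingC/cr; lia.
by have := meets_exchange fT gT cr14 m14 m41; rewrite m11 m44.
Qed.

End Trees.

(** * Distance tuples *)

Lemma size_undup_map_le (T A B : eqType) (f : T -> A) (g : T -> B) (e : seq T) :
    (forall x y, g x = g y -> f x = f y) ->
  size (undup (map f e)) <= size (undup (map g e)).
Proof.
move=> fg; elim: e => //= x e IHe.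
case: ifP => fx; case: ifP => gx //=; first exact: leqW.
by case/mapP: gx fx => y ye /fg ->; rewrite map_f.
Qed.

Section Tuples.
Variables (G : sgraph) (sigma : {perm dart G}) (d0 : dart G).
Hypotheses (Gconn : connected_graph G) (planar : planar_embedding sigma).
Implicit Types (i j k : nat) (v w : G) (I J : seq nat).

Local Notation phi := (face_next sigma).
Local Notation c := (corner sigma d0).

(** A comparison of two differences, written additively because subtraction truncates. *)
Definition shrinks i v w :=
  dist (c i.+1) v + dist (c i) w < dist (c i) v + dist (c i.+1) w.

(* Two shortest paths with a common vertex could exchange their ends there. *)
Lemma shrinks_disjoint i v w :
  shrinks i v w -> ~~ meets (parent v) (parent w) (c i.+1) (c i).
Proof.
move=> lt_vw; apply/existsP => -[z /andP[]].
move=> /(dist_ancestor Gconn) vb /(dist_ancestor Gconn) wa.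
move: lt_vw vb wa (dist_triangle Gconn z v (c i)) (dist_triangle Gconn z w (c i.+1)).
rewrite /shrinks !(dist_sym Gconn _ v) !(dist_sym Gconn _ w); lia.
Qed.

Lemma parent_tree v : tree_fun (parent v) v.
Proof. by split=> x; [exact: parent_edge|exact: parent_root]. Qed.

Lemma no_alternation v w i1 i2 i3 i4 :
    i1 < i2 < i3 -> i3 < i4 -> i4.+1 < fingraph.order phi d0 ->
    shrinks i1 v w -> shrinks i2 w v -> shrinks i3 v w -> shrinks i4 w v ->
  False.
Proof.
move=> /andP[i12 i23] i34 i4n.
move=> /shrinks_disjoint m1 /shrinks_disjoint m2 /shrinks_disjoint m3 /shrinks_disjoint m4.
rewrite meetsC in m2; rewrite meetsC in m4.
(* The leaves are the corners [i] and [i.+1] of the four steps. Successive steps may share a corner,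
   hence the weak order. *)
apply: (no_disjoint_trees (parent_tree v) (parent_tree w) _ _ i4n m1 m2 m3 m4).
  move=> i j k l ijk kl A B; exact: (linked_cross Gconn planar ijk kl).
by rewrite /= !leqnSn i12 i23 i34.
Qed.

(** Both bits are monotone in the difference of distances: a bit set for [v] but not for [w] means a
    smaller difference for [v]. *)
Definition step_bits v i :=
  [:: dist (c i.+1) v < dist (c i) v; dist (c i.+1) v <= dist (c i) v].

Definition bits I v := flatten [seq step_bits v i | i <- I].

Fixpoint alternating b v w J :=
  if J is i :: J' then
    (if b then shrinks i v w else shrinks i w v) && alternating (~~ b) v w J'
  else true.

(** By monotonicity the two bits of one step cannot differ in opposite directions, so successive
    alternations come from distinct steps. *)
Lemma alternates_bits I b r v w : alternates b r (bits I v) (bits I w) ->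
  exists J, [/\ subseq J I, size J = r & alternating b v w J].
Proof.
elim: I b r => [|i I IHI] b r.
  by move=> /eqP ->; exists [::].
case: r => [|r]; first by exists [::]; rewrite sub0seq.
have take_i : alternates (~~ b) r (bits I v) (bits I w) ->
    (if b then shrinks i v w else shrinks i w v) ->
  exists J, [/\ subseq J (i :: I), size J = r.+1 & alternating b v w J].
  move=> /IHI[J [sJ <- altJ]] iJ; exists (i :: J).
  by rewrite /= eqxx iJ.
rewrite /bits /= -!/(bits I _).
case/or3P => [/and3P[/eqP b1 /eqP b2]|/and3P[/eqP b1 /eqP b2 alt]|/IHI[J [sJ sz altJ]]].
- move=> alt; apply: take_i; last first.
    by move: b1 b2; rewrite /shrinks; case: (b) => /=; lia.
  case: r {IHI} alt => [|r].
    by move=> _; case: (bits I v) (bits I w) => [|? ?] [].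
  case/orP => // /and3P[/eqP b3 /eqP b4].
  by move: b1 b2 b3 b4; case: (b) => /=; lia.
- apply: take_i => //.
  by move: b1 b2; rewrite /shrinks; case: (b) => /=; lia.
by exists J; split=> //; apply: subseq_trans sJ (subseq_cons _ _).
Qed.

Lemma bits_alternation_free I b v w :
    sorted ltn I -> all (fun i => i.+1 < fingraph.order phi d0) I ->
  ~~ alternates b 4 (bits I v) (bits I w).
Proof.
move=> sI ltI; apply/negP => /alternates_bits[J [sJ szJ altJ]].
have := subseq_sorted ltn_trans sJ sI.
have /allP/(_ (nth 0 J 3)) := ltI => /(_ (mem_subseq sJ (mem_nth _ _))).
case: J szJ altJ {sJ} => [|i1 [|i2 [|i3 [|i4 []]]]] //= _ altJ /(_ isT) i4n.
move=> /and4P[i12 i23 i34 _]; have i123 : i1 < i2 < i3 by rewrite i12.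
case: b altJ => /= /and5P[s1 s2 s3 s4 _].
  exact: (no_alternation i123 i34 i4n s1 s2 s3 s4).
exact: (no_alternation i123 i34 i4n s1 s2 s3 s4).
Qed.

Lemma edge_corner i : edge (c i) (c i.+1).
Proof.
rewrite /corner iterS (tail_next planar); exact: (valP (iter i phi d0)).
Qed.

(** Consecutive corners are adjacent, so the difference is -1, 0 or 1 and the two bits determine
    it. *)
Lemma step_bits_dist i v w :
    dist (c i) v = dist (c i) w -> step_bits v i = step_bits w i ->
  dist (c i.+1) v = dist (c i.+1) w.
Proof.
move=> eq_i [lt_i le_i].
have lip u : dist (c i) u <= (dist (c i.+1) u).+1 /\ dist (c i.+1) u <= (dist (c i) u).+1.
  have [ii1 i1i] := (edge_corner i, edge_corner i); rewrite edge_sym in i1i.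
  move: (dist_triangle Gconn (c i.+1) (c i) u) (dist_triangle Gconn (c i) (c i.+1) u).
  move: (dist_edge ii1) (dist_edge i1i); lia.
move: (lip v) (lip w) lt_i le_i; rewrite -eq_i; lia.
Qed.

Lemma bits_inj I v w i : bits I v = bits I w -> i \in I -> step_bits v i = step_bits w i.
Proof.
elim: I => //= j I IHI [lt_j le_j /IHI IH]; rewrite inE => /orP[/eqP ->|//].
by rewrite /step_bits lt_j le_j.
Qed.

(** A step back to a vertex already met adds no information. Skipping these bounds the code length
    by the number of distinct sources, although the face walk may repeat cut vertices. The range
    ends at [m.-1] because step [i] reaches corner [i.+1]. *)
Definition fresh_steps m :=
  [seq i <- iota 0 m.-1 | c i.+1 \notin [seq c k | k <- iota 0 i.+1]].

Lemma fresh_steps_dist m v w :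
    dist (c 0) v = dist (c 0) w -> bits (fresh_steps m) v = bits (fresh_steps m) w ->
  forall k, k < m -> dist (c k) v = dist (c k) w.
Proof.
move=> eq0 eq_bits k; have [n] := ubnP k; elim: n k => // n IHn [//|k] lt_kn lt_km.
case: (boolP (c k.+1 \in [seq c j | j <- iota 0 k.+1])) => [/mapP[j]|fresh].
  rewrite mem_iota /= add0n => lt_jk ->; apply: IHn; lia.
apply: step_bits_dist; first by apply: IHn; lia.
apply: bits_inj eq_bits _; rewrite mem_filter fresh mem_iota /=; lia.
Qed.

(** The first corner and the ends of the fresh steps are pairwise distinct sources. *)
Lemma size_fresh_steps m : 0 < m ->
  size (fresh_steps m) < #|[set x in [seq c k | k <- iota 0 m]]|.
Proof.
move=> m_gt0; pose t := c 0 :: [seq c i.+1 | i <- fresh_steps m].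
have -> : (size (fresh_steps m)).+1 = size t by rewrite /= size_map.
have fresh_neq i j : i \in fresh_steps m -> j <= i -> c i.+1 != c j.
  rewrite mem_filter => /andP[fresh _] le_ji; apply: contraNneq fresh => ->.
  by rewrite map_f // mem_iota.
have ut : uniq t.
  rewrite /t cons_uniq; apply/andP; split.
    by apply/mapP => -[i /fresh_neq/(_ (leq0n _))/eqP neq] /esym.
  rewrite map_inj_in_uniq ?filter_uniq ?iota_uniq // => i j iI jI /eqP.
  case: (ltngtP i j) => // [lt_ij|lt_ji].
    by rewrite eq_sym (negbTE (fresh_neq j i.+1 jI lt_ij)).
  by rewrite (negbTE (fresh_neq i j.+1 iI lt_ji)).
rewrite -(card_uniqP ut); apply/subset_leq_card/subsetP => x.
rewrite inE => /predU1P[->|/mapP[i]]; first by rewrite map_f // mem_iota.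
rewrite mem_filter mem_iota => /andP[_ lt_i] ->.
by rewrite map_f // mem_iota /=; lia.
Qed.

Lemma dist_le_diameter v w : dist v w <= diameter G.
Proof.
by apply: (bigmax_sup v) => //; apply: (bigmax_sup w).
Qed.

Lemma nb_dist_tuples_corner m (s : seq G) :
    0 < m <= fingraph.order phi d0 -> s = [seq c k | k <- iota 0 m] ->
  nb_dist_tuples s <= (diameter G).+1 * (#|[set x in s]|).*2 ^ 3.
Proof.
move=> /andP[m_gt0 le_m] sE; pose I := fresh_steps m.
pose code v := (dist (c 0) v, bits I v).
have code_tuple v w : code v = code w -> dist_tuple s v = dist_tuple s w.
  case=> eq0 eqI; rewrite /dist_tuple sE -!map_comp; apply/eq_in_map => k.
  by rewrite mem_iota => /(fresh_steps_dist eq0 eqI).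
apply: leq_trans (size_undup_map_le _ code_tuple) _.
pose L := undup [seq bits I v | v <- enum G].
(* Two bits per step give the length, and the absence of four alternations gives the exponent 3. *)
have leL : size L <= (size I).*2.+1 ^ 3.
  apply: alternation_free_count; first exact: undup_uniq.
    apply/allP => x; rewrite mem_undup => /mapP[v _ ->].
    by rewrite /bits; elim: (I) => //= i I' /eqP ->.
  move=> b x y; rewrite !mem_undup => /mapP[v _ ->] /mapP[w _ ->].
  apply: bits_alternation_free.
    exact: (sorted_filter ltn_trans _ (iota_ltn_sorted _ _)).
  apply/allP => i; rewrite mem_filter mem_iota => /andP[_]; lia.
apply: (@leq_trans (size [seq (a, x) | a <- iota 0 (diameter G).+1, x <- L])).
  apply: uniq_leq_size; first exact: undup_uniq.
  move=> -[a x]; rewrite mem_undup => /mapP[v _ [-> ->]].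
  apply: allpairs_f; first by rewrite mem_iota /= ltnS dist_le_diameter.
  by rewrite mem_undup map_f // mem_enum.
rewrite size_allpairs size_iota leq_mul2l /= (leq_trans leL) //.
(* From [|I| < |S|] follows [2 |I| + 1 <= 2 |S|]. *)
rewrite leq_exp2r //; have := size_fresh_steps m_gt0.
by rewrite -sE -/I -leq_double doubleS => /ltnW.
Qed.

End Tuples.

Theorem theorem3p2 :
  exists C : nat,
    forall (G : sgraph) (sigma : {perm dart G}) (s : seq G),
      connected_graph G ->
      planar_embedding sigma ->
      consecutive_on_face sigma s ->
      0 < size s ->
      0 < diameter G ->
      nb_dist_tuples s <= C * (#|[set x in s]| ^ 3 * diameter G).
Proof.
(* A factor 8 comes from [(2 |S|)^3] and a factor 2 from [D + 1 <= 2 D], valid as [D > 0]. *)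
exists 16 => G sigma s Gconn planar [d [m [le_m sE]]] s_gt0 D_gt0.
have {}sE : s = [seq corner sigma d k | k <- iota 0 m].
  rewrite sE; apply: (@eq_from_nth _ (tail d)) => [|k].
    by rewrite !size_map size_traject size_iota.
  rewrite size_map size_traject => lt_k.
  by rewrite (nth_map d) ?size_traject // nth_traject // (nth_map 0) ?size_iota // nth_iota.
have m_gt0 : 0 < m by move: s_gt0; rewrite sE size_map size_iota.
have m_bounds : 0 < m <= fingraph.order (face_next sigma) d by rewrite m_gt0.
apply: leq_trans (nb_dist_tuples_corner Gconn planar m_bounds sE) _.
rewrite -muln2 expnMn; move: (_ ^ 3) D_gt0; nia.
Qed.
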